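(* Let $X,Y$ be finite posets, for each $x\in X$ let $Y_x\subseteq Y$ be totally ordered, let $\Psi$ be a set of pairs $(x_1,x_2)$ in $X$ with $x_1<x_2$, and let $T$ be the set of tableaux $f:X\to Y$ with $f(x)\in Y_x$ for all $x$, $f(x_1)\le f(x_2)$ whenever $x_1\le x_2$, and $f(x_1)<f(x_2)$ whenever $(x_1,x_2)\in\Psi$. Set $E=\bigcup_{f\in T}f$ and $\Delta=\Delta(X,Y,T,E)$. For $f\in T$ and $x\in X$ let $U_f(x)$ be the set of $y\in Y$ with $f(x)<y$ such that changing the value of $f$ at $x$ from $f(x)$ to $y$ yields a tableau in $T$. Then \[K(S/I_\Delta;\mathbf t)=\sum_{f\in T}\prod_{x\in X}\Bigg(\big(1-t_{v_{(x,f(x))}}\big)\prod_{y\in U_f(x)}t_{v_{(x,y)}}\Bigg).\] Moreover, for each $j$, the entry $h_j$ of the $h$-vector of $S/I_\Delta$ equals the number of tableaux $f\in T$ with $\sum_{x\in X}|U_f(x)|=j$.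
   Context: A tableau is a function $f:X\to Y$ identified with its graph in $X\times Y$. Put $v_{(x,y)}:=E\setminus\{(x,y)\}$ for $(x,y)\in E$ and $V=\{v_{(x,y)}:(x,y)\in E\}$. The tableau complex $\Delta(X,Y,T,E)$ is the simplicial complex on ground set $V$ whose faces are the sets $\{v_{(x,y)}:(x,y)\in E\setminus F\}$ for $F\subseteq E$ containing some $f\in T$. Let $\mathbb{k}$ be a field, $S=\mathbb{k}[V]$, and $I_\Delta$ the Stanley–Reisner ideal, generated by $\prod_{v\in G}v$ for non-faces $G\subseteq V$. With the $\mathbb Z^V$-grading (variable $v$ of degree $t_v$), $K(S/I_\Delta;\mathbf t)$ is the numerator of the Hilbert series of $S/I_\Delta$ over $\prod_{v\in V}(1-t_v)$. The $h$-vector $(h_0,\dots,h_d)$ is defined by writing the $\mathbb Z$-graded Hilbert series (all $t_v\mapsto t$) as $\sum_j h_jt^j/(1-t)^d$, $d$ the Krull dimension of $S/I_\Delta$. *)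

(* Defs.v *)
From HB Require Import structures.
From mathcomp Require Import all_boot all_order all_algebra.
From mathcomp Require Export mpoly.

Set Implicit Arguments.
Unset Strict Implicit.
Unset Printing Implicit Defensive.

Import Order.TTheory GRing.Theory.

Local Open Scope ring_scope.

(* The polynomial ring R[V] over a ground set V : {set U} is {mpoly R[#|V|]},
   whose i-th variable stands for enum_val i \in V. The value 0 is a default
   for elements v outside V. *)
Definition pvar (R : nzRingType) (U : finType) (V : {set U}) (v : U) :
    {mpoly R[#|V|]} :=
  if [pick i : 'I_#|V| | enum_val i == v] is Some i then 'X_i else 0.

Section Ideals.
Variable S : comNzRingType.

(* Ideals are Prop-valued predicates: the ideals of ring_quotient are boolean,
   and moreover proper, which would exclude the unit ideal. *)
Definition is_ideal (P : S -> Prop) : Prop :=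
  [/\ P 0, forall a b, P a -> P b -> P (a + b) & forall a b, P b -> P (a * b)].

Definition is_prime_ideal (P : S -> Prop) : Prop :=
  [/\ is_ideal P, ~ P 1 & forall a b, P (a * b) -> P a \/ P b].

(* Primes of S / I are identified with the primes of S containing I. *)
Definition has_prime_chain (I : S -> Prop) (d : nat) : Prop :=
  exists P : 'I_d.+1 -> S -> Prop,
    [/\ forall i, is_prime_ideal (P i),
        forall i a, I a -> P i a &
        forall i j : 'I_d.+1, (i < j)%N ->
          (forall a, P i a -> P j a) /\ (exists a, P j a /\ ~ P i a)].

(* The Krull dimension of S / I is d; no d qualifies when S / I = 0. *)
Definition krull_dim_quot (I : S -> Prop) (d : nat) : Prop :=
  has_prime_chain I d /\ forall e, has_prime_chain I e -> (e <= d)%N.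

End Ideals.

(* dim_k (A / (A \cap I)) = n, for subspaces A and I of M: some n vectors of A
   form a basis of A modulo I. *)
Definition quot_dim (k : fieldType) (M : lmodType k) (A I : M -> Prop)
    (n : nat) : Prop :=
  exists b : 'I_n -> M,
    [/\ forall i, A (b i),
        forall p, A p ->
          exists c : 'I_n -> k, I (p - \sum_(i < n) c i *: b i) &
        forall c : 'I_n -> k,
          I (\sum_(i < n) c i *: b i) -> forall i, c i = 0].

Section Hilbert.
Variables (k : fieldType) (n : nat).

(* The component of degree g of k[x_1, ..., x_n] when monomials are graded by
   deg; deg := id gives the fine grading, deg := mdeg the standard one. *)
Definition graded_piece (G : eqType) (deg : 'X_{1..n} -> G) (g : G)
    (p : {mpoly k[n]}) : Prop :=
  forall m, m \in msupp p -> deg m = g.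

Definition hilbert_function (G : eqType) (deg : 'X_{1..n} -> G)
    (I : {mpoly k[n]} -> Prop) (H : G -> nat) : Prop :=
  forall g, quot_dim (graded_piece deg g) I (H g).

(* Coefficient of t^a in the product of D with the power series
   \sum_b H(b) t^b. *)
Definition coef_mul_series (D : {mpoly int[n]}) (H : 'X_{1..n} -> nat)
    (a : 'X_{1..n}) : int :=
  \sum_(b <- msupp D | (b <= a)%MM) D@_b * (H (a - b)%MM)%:Z.

(* K is the numerator of the finely graded Hilbert series of S / I over
   \prod_i (1 - t_i), i.e. their product as formal power series. *)
Definition is_K_polynomial (I : {mpoly k[n]} -> Prop) (K : {mpoly int[n]}) :
    Prop :=
  exists2 H : 'X_{1..n} -> nat,
    hilbert_function id I H &
    forall a, K@_a = coef_mul_series (\prod_(i < n) (1 - 'X_i)) H a.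

(* h = [:: h_0; ...; h_d] with \sum_j h_j t^j = (1 - t)^d * Hilb(S / I; t),
   d the Krull dimension. The zero ring (dimension -oo, Hilbert series 0) has
   the empty h-vector; the convention is h_j = 0 for j out of range. *)
Definition is_h_vector (I : {mpoly k[n]} -> Prop) (h : seq int) : Prop :=
  (I 1 /\ h = [::]) \/
  exists (d : nat) (H : nat -> nat),
    [/\ krull_dim_quot I d,
        hilbert_function (@mdeg n) I H,
        size h = d.+1 &
        forall j, h`_j =
          \sum_(i < j.+1) ((1 - 'X) ^+ d : {poly int})`_i * (H (j - i)%N)%:Z].

End Hilbert.

Definition SR_ideal (k : fieldType) (U : finType) (V : {set U})
    (D : {set {set U}}) (p : {mpoly k[#|V|]}) : Prop :=
  exists c : {set U} -> {mpoly k[#|V|]},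
    p = \sum_(G : {set U} | (G \subset V) && (G \notin D))
          c G * \prod_(v in G) pvar k V v.

Section Tableaux.
Variables X Y : finType.
Implicit Types (T : {set {ffun X -> Y}}) (E : {set X * Y}).

Definition graph (f : {ffun X -> Y}) : {set X * Y} := [set (x, f x) | x in X].

Definition tab_vertex E (e : X * Y) : {set X * Y} := E :\ e.

Definition tab_ground E : {set {set X * Y}} := [set tab_vertex E e | e in E].

Definition tableau_complex T E : {set {set {set X * Y}}} :=
  [set [set tab_vertex E e | e in E :\: F]
     | F in powerset E & [exists f in T, graph f \subset F]].

Definition tab_union T : {set X * Y} := \bigcup_(f in T) graph f.

Definition change (f : {ffun X -> Y}) (x : X) (y : Y) : {ffun X -> Y} :=
  [ffun x' => if x' == x then y else f x'].

End Tableaux.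

Definition poset_tableaux (dX dY : Order.disp_t) (X : finPOrderType dX)
    (Y : finPOrderType dY) (Y_ : X -> {set Y}) (Psi : {set X * X}) :
    {set {ffun X -> Y}} :=
  [set f : {ffun X -> Y} |
    [&& [forall x, f x \in Y_ x],
        [forall x1, forall x2, (x1 <= x2)%O ==> (f x1 <= f x2)%O] &
        [forall x1, forall x2, ((x1, x2) \in Psi) ==> (f x1 < f x2)%O]]].

Definition up_moves (X : finType) (dY : Order.disp_t) (Y : finPOrderType dY)
    (T : {set {ffun X -> Y}}) (f : {ffun X -> Y}) (x : X) : {set Y} :=
  [set y | (f x < y)%O && (change f x y \in T)].

(* Main.v *)
Require Import Defs.
From Stdlib Require Import Classical_Prop.
From HB Require Import structures.
From mathcomp Require Import all_boot all_order all_algebra.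
From mathcomp Require Import mpoly.

(** For a set [F] of pairs, the tableaux of [T] contained in [F] are closed
    under pointwise maximum, so they have a greatest element as soon as there is
    one; it is also the only one that cannot be raised inside [F] at a single
    [x] (raise at a maximal [x] where it differs from the greatest tableau).
    Hence the faces [E :\: F] of the tableau complex are partitioned into the
    intervals from [U_f] to [E :\: f], for [f] in [T]. The face monomials in
    such an interval contribute [prod_(U_f) t * prod_f (1 - t)] to the
    K-polynomial, and setting all variables to [t] and cancelling
    [(1 - t) ^ #|X|] gives the h-vector.

    The Krull dimension is [d := #|E| - #|X|]. Chains of ideals generated by
    variables give the lower bound. For the upper bound, a prime containing
    the ideal contains the variables of some [f]; modulo these variables any
    [d + 1] polynomials are algebraically dependent, whereas elements [a_i] of
    [P_(i+1)] outside [P_i], for a chain of primes [P_i], are algebraically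
    independent modulo [P_0]. *)

Import Order.TTheory GRing.Theory.

Local Open Scope ring_scope.

Set Implicit Arguments.
Unset Strict Implicit.
Unset Printing Implicit Defensive.

(** * Hilbert functions of monomial ideals *)

Lemma exists_row_kernel (k : fieldType) (m n : nat) (A : 'M[k]_(m, n)) :
  (n < m)%N -> exists2 u : 'rV[k]_m, u != 0 & u *m A = 0.
Proof.
move=> ltnm.
have: kermx A != 0.
  rewrite -mxrank_eq0 mxrank_ker subn_eq0 -ltnNge.
  exact: leq_ltn_trans (rank_leq_col A) ltnm.
case/rowV0Pn=> u /sub_kermxP uA0 u_neq0; by exists u.
Qed.

Section QuotientDimension.
Variables (k : fieldType) (M : lmodType k) (A I : M -> Prop).
Hypotheses (I0 : I 0) (ID : forall a b, I a -> I b -> I (a + b))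
  (IZ : forall (c : k) a, I a -> I (c *: a)).

(** Steinitz exchange modulo [I]: if [n < m], a nonzero row killing the matrix that expresses the
    [b i] in the [b' j] gives a nontrivial relation among the [b i]. *)
Lemma quot_dim_leq m n : quot_dim A I m -> quot_dim A I n -> (m <= n)%N.
Proof.
case=> b [Ab _ freeb] [b' [_ genb' _]]; rewrite leqNgt; apply/negP=> ltnm.
have [C HC] : exists C : 'I_m -> 'I_n -> k,
    forall i, I (b i - \sum_(j < n) C i j *: b' j).
  exact: fin_all_exists (fun i => genb' _ (Ab i)).
have [u u_neq0 uC0] := exists_row_kernel (\matrix_(i, j) C i j) ltnm.
case/eqP: u_neq0; apply/rowP=> i; rewrite mxE.
apply: (freeb (fun i => u ord0 i)) => {i}.
have -> : \sum_(i < m) u ord0 i *: b i =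
    \sum_(i < m) u ord0 i *: (b i - \sum_(j < n) C i j *: b' j).
  under [RHS]eq_bigr => i _ do rewrite scalerBr.
  rewrite sumrB; set s := (X in _ = _ - X).
  suff -> : s = 0 by rewrite subr0.
  rewrite /s; under eq_bigr => i _ do rewrite scaler_sumr.
  rewrite exchange_big /= big1 // => j _.
  under eq_bigr => i _ do rewrite scalerA.
  rewrite -scaler_suml.
  have /rowP/(_ j) := uC0; rewrite !mxE.
  by under eq_bigr => i _ do rewrite mxE; move=> ->; rewrite scale0r.
by apply: big_ind => // i _; apply: IZ.
Qed.

Lemma quot_dim_inj m n : quot_dim A I m -> quot_dim A I n -> m = n.
Proof. by move=> hm hn; apply/eqP; rewrite eqn_leq !quot_dim_leq. Qed.

End QuotientDimension.

Section MonomialIdeal.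
Variables (k : fieldType) (n : nat) (face : pred 'X_{1..n}).
Variable I : {mpoly k[n]} -> Prop.
Hypothesis I_msupp : forall p, I p <-> {in msupp p, forall m, ~~ face m}.

Lemma mono_idealD a b : I a -> I b -> I (a + b).
Proof.
move=> /I_msupp Ia /I_msupp Ib; apply/I_msupp => m /msuppD_le.
by rewrite mem_cat => /orP[/Ia|/Ib].
Qed.

Lemma mono_ideal0 : I 0.
Proof. by apply/I_msupp => m; rewrite msupp0. Qed.

Lemma mono_idealZ (c : k) a : I a -> I (c *: a).
Proof. by move=> /I_msupp Ia; apply/I_msupp => m /msuppZ_le/Ia. Qed.

Section Count.
Variables (G : eqType) (deg : 'X_{1..n} -> G) (g : G) (s : seq 'X_{1..n}).
Hypotheses (s_uniq : uniq s)
  (mem_s : forall m, (m \in s) = (deg m == g) && face m).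

Let mcoeff_comb (c : 'I_(size s) -> k) (m : 'X_{1..n}) :
  (\sum_(i < size s) c i *: 'X_[nth 0%MM s i])@_m =
  \sum_(i < size s | nth 0%MM s i == m) c i.
Proof.
rewrite linear_sum /= [RHS]big_mkcond /=; apply: eq_bigr => i _.
by rewrite mcoeffZ mcoeffX; case: eqP; rewrite ?mulr1 ?mulr0.
Qed.

Let sum_nth (c : 'I_(size s) -> k) (i : 'I_(size s)) :
  \sum_(j < size s | nth 0%MM s j == nth 0%MM s i) c j = c i.
Proof.
rewrite (eq_bigl (pred1 i)) ?big_pred1_eq // => j /=.
by rewrite nth_uniq ?ltn_ord.
Qed.

(** The monomials in [s] form a basis: removing from [p] its face terms leaves only non-face
    monomials. *)
Lemma quot_dim_graded : quot_dim (graded_piece deg g) I (size s).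
Proof.
exists (fun i => 'X_[nth 0%MM s i]); split.
- move=> i m /mem_msuppXP <-; apply/eqP.
  by have := mem_nth 0%MM (ltn_ord i); rewrite mem_s => /andP[].
- move=> p pg; exists (fun i => p@_(nth 0%MM s i)); apply/I_msupp => m.
  apply: contraL => fm; rewrite -mcoeff_eq0 mcoeffB mcoeff_comb.
  case: (boolP (m \in s)) => [/(nthP 0%MM)[i lti <-]|m_s].
    by rewrite (sum_nth (fun i => p@_(nth 0%MM s i)) (Ordinal lti)) subrr.
  rewrite big1 ?subr0 => [|i /eqP e]; last first.
    by move: m_s; rewrite -e mem_nth ?ltn_ord.
  rewrite mcoeff_eq0; apply: contra m_s => /pg e.
  by rewrite mem_s e eqxx.
- move=> c /I_msupp Ic i; apply/eqP.
  apply: contraTT (mem_nth 0%MM (ltn_ord i)) => ci_neq0.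
  rewrite mem_s negb_and (Ic _ _) ?orbT //.
  by rewrite mcoeff_msupp mcoeff_comb sum_nth.
Qed.

Lemma quot_dim_gradedE d : quot_dim (graded_piece deg g) I d -> d = size s.
Proof.
move=> hd; apply: (quot_dim_inj (A := graded_piece deg g) (I := I)) => //.
- exact: mono_ideal0.
- exact: mono_idealD.
- exact: mono_idealZ.
- exact: quot_dim_graded.
Qed.

End Count.

Lemma hilbert_function_fineP H :
  hilbert_function id I H <-> H =1 fun m => nat_of_bool (face m).
Proof.
(* A fine degree contains a single monomial, so the list of its faces is [[:: g]] or empty. *)
have mems (g m : 'X_{1..n}) :
    (m \in nseq (face g) g) = (id m == g) && face m.
  by rewrite mem_nseq lt0b andbC; case: eqP => //= ->.
have us (g : 'X_{1..n}) : uniq (nseq (face g) g) by case: (face g).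
split=> [hH g|hH g].
  by rewrite (quot_dim_gradedE (us g) (mems g) (hH g)) size_nseq.
have := quot_dim_graded (us g) (mems g).
by rewrite size_nseq hH.
Qed.

(** The bound [N] makes the type of monomials finite; the count is the same for every [N > j]. *)
Definition faces_of_deg N j :=
  [set m : 'X_{1..n < N} | (mdeg m == j) && face m].

Let face_seq N j := [seq val m | m <- enum (faces_of_deg N j)].

Let face_seq_uniq N j : uniq (face_seq N j).
Proof. by rewrite map_inj_uniq ?enum_uniq //; apply: val_inj. Qed.

Let mem_face_seq N j m :
  (j < N)%N -> (m \in face_seq N j) = (mdeg m == j) && face m.
Proof.
move=> ltjN; apply/mapP/idP => [[m' +] ->|]; first by rewrite mem_enum inE.
case/andP=> /[dup] /eqP dm dm' fm.
have ltm : (mdeg m < N)%N by rewrite dm.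
by exists (BMultinom ltm); rewrite // mem_enum inE /= dm' fm.
Qed.

Let size_face_seq N j : size (face_seq N j) = #|faces_of_deg N j|.
Proof. by rewrite size_map -cardE. Qed.

Lemma hilbert_function_mdeg :
  hilbert_function (@mdeg n) I (fun j => #|faces_of_deg j.+1 j|).
Proof.
move=> j; rewrite -size_face_seq; apply: quot_dim_graded => // m.
exact: mem_face_seq.
Qed.

Lemma hilbert_function_mdegE H j N :
  hilbert_function (@mdeg n) I H -> (j < N)%N -> H j = #|faces_of_deg N j|.
Proof.
move=> hH ltjN; rewrite -size_face_seq.
by apply: (quot_dim_gradedE _ _ (hH j)) => // m; apply: mem_face_seq.
Qed.

End MonomialIdeal.

(** * Products of linear factors and their action on power series *)

Definition mnm_ind n (J : {set 'I_n}) : 'X_{1..n} :=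
  [multinom nat_of_bool (i \in J) | i < n].

Lemma mpolyX_ind (R : nzRingType) n (J : {set 'I_n}) :
  'X_[R, mnm_ind J] = \prod_(i in J) 'X_i.
Proof.
rewrite mpolyXE_id [RHS]big_mkcond; apply: eq_bigr => i _.
by rewrite mnmE; case: ifP.
Qed.

Lemma prod_linear_expand (R : comNzRingType) n (al be : 'I_n -> R) :
  \prod_i ((be i)%:MP * 'X_i + (al i)%:MP : {mpoly R[n]}) =
  \sum_(J : {set 'I_n}) (\prod_i if i \in J then be i else al i) *:
    'X_[mnm_ind J].
Proof.
rewrite bigA_distr; apply: eq_bigr => J _.
rewrite -mul_mpolyC rmorph_prod mpolyX_ind /= [X in _ * X]big_mkcond -big_split.
by apply: eq_bigr => i _ /=; case: ifP => //; rewrite mulr1.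
Qed.

(** When both sides are expanded over the sets [J], a term can survive only if [a] is the indicator
    of [J]. *)
Lemma mcoeff_prod_linear (R : comNzRingType) n (al be : 'I_n -> R) a :
  (\prod_i ((be i)%:MP * 'X_i + (al i)%:MP : {mpoly R[n]}))@_a =
  \prod_i (be i *+ (a i == 1%N) + al i *+ (a i == 0%N)).
Proof.
rewrite prod_linear_expand linear_sum /= bigA_distr; apply: eq_bigr => J _.
rewrite mcoeffZ mcoeffX; case: eqP => [<-|neq].
  rewrite mulr1; apply: eq_bigr => i _.
  by rewrite mnmE; case: (i \in J).
have [i ni] : exists i, mnm_ind J i != a i.
  apply/existsP; apply: contra_notT neq; rewrite negb_exists => /forallP h.
  by apply/mnmP => i; apply/eqP; rewrite -[_ == _]negbK h.
rewrite mulr0 (bigD1 i) //=.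
by move: ni; rewrite mnmE; case: (i \in J); case: (a i) => [|[|c]] //=;
  rewrite mul0r.
Qed.

Lemma mcoeffXM_lem (R : comNzRingType) n (m a : 'X_{1..n}) (p : {mpoly R[n]}) :
  ('X_[m] * p)@_a = if (m <= a)%MM then p@_(a - m) else 0.
Proof.
case: ifP => [le_ma|nle_ma];
  first by rewrite -{1}(submK le_ma) addmC mulrC mcoeffMX.
apply: memN_msupp_eq0; rewrite mulrC (perm_mem (msuppMX _ _)).
by apply/mapP => -[m' _ e]; rewrite e lem_addr in nle_ma.
Qed.

Section CoefMulSeries.
Variable n : nat.
Implicit Types (D : {mpoly int[n]}) (H : 'X_{1..n} -> nat) (a : 'X_{1..n}).

(** Agrees with the power series below degree [N], so that products can be taken in the polynomial
    ring. *)
Definition trunc_series H N : {mpoly int[n]} :=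
  \sum_(m : 'X_{1..n < N}) (H m)%:Z *: 'X_[m].

Lemma coef_mul_seriesE D H a N : (mdeg a < N)%N ->
  coef_mul_series D H a = (D * trunc_series H N)@_a.
Proof.
move=> lt_aN; rewrite {2}[D]mpolyE mulr_suml linear_sum /= /coef_mul_series.
rewrite big_mkcond; apply: eq_bigr => b _.
rewrite -scalerAl mcoeffZ mcoeffXM_lem; case: ifP => _; last by rewrite mulr0.
by rewrite (mcoeff_mpoly (fun m => (H m)%:Z)) // (leq_ltn_trans (mdegB _ _)).
Qed.

Lemma coef_mul_series_monomials (J : finType) (c : J -> int)
    (b : J -> 'X_{1..n}) H a :
  coef_mul_series (\sum_j c j *: 'X_[b j]) H a =
  \sum_(j | (b j <= a)%MM) c j * (H (a - b j)%MM)%:Z.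
Proof.
rewrite (@coef_mul_seriesE _ _ _ (mdeg a).+1) // mulr_suml linear_sum /=.
rewrite [RHS]big_mkcond; apply: eq_bigr => j _ /=.
rewrite -scalerAl mcoeffZ mcoeffXM_lem; case: ifP => _; last by rewrite mulr0.
by rewrite (mcoeff_mpoly (fun m => (H m)%:Z)) // ltnS mdegB.
Qed.

Lemma coef_mul_series_sum (F : finType) (P : pred F) D
    (H : F -> 'X_{1..n} -> nat) a :
  coef_mul_series D (fun m => \sum_(f | P f) H f m)%N a =
  \sum_(f | P f) coef_mul_series D (H f) a.
Proof.
rewrite exchange_big /=; apply: eq_bigr => b _.
rewrite -mulr_sumr; congr (_ * _).
by rewrite -natz natr_sum; apply: eq_bigr => f _; rewrite natz.
Qed.

Lemma eq_coef_mul_series D H H' a :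
  H =1 H' -> coef_mul_series D H a = coef_mul_series D H' a.
Proof. by move=> e; apply: eq_bigr => b _; rewrite e. Qed.

Lemma prod_1BX_expand :
  \prod_(i < n) (1 - 'X_i) =
  \sum_(J : {set 'I_n}) (-1) ^+ #|J| *: 'X_[mnm_ind J] :> {mpoly int[n]}.
Proof.
transitivity (\prod_(i < n) ((-1)%:MP * 'X_i + 1%:MP) : {mpoly int[n]}).
  by apply: eq_bigr => i _; rewrite mpolyCN mpolyC1 mulN1r addrC.
rewrite prod_linear_expand; apply: eq_bigr => J _; congr (_ *: _).
by rewrite -big_mkcond /= prodr_const.
Qed.

(** Each factor [1 - 'X_i] takes the difference of consecutive values of [chi i]. The factor
    [a i != 0] drops the predecessor at [0], where [.-1] would give [0] again. *)
Lemma coef_mul_series_prod (chi : 'I_n -> nat -> nat) a :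
  coef_mul_series (\prod_(i < n) (1 - 'X_i)) (fun m => \prod_i chi i (m i))%N a
  = \prod_i ((chi i (a i))%:Z - (chi i (a i).-1 * (a i != 0))%N%:Z).
Proof.
rewrite prod_1BX_expand coef_mul_series_monomials.
transitivity (\prod_i (- (chi i (a i).-1 * (a i != 0))%N%:Z + (chi i (a i))%:Z)).
  rewrite bigA_distr big_mkcond; apply: eq_bigr => J _.
  case: ifP => [/mnm_lepP leJa|/negbT /forallPn /= [i]].
    rewrite -prodr_const big_mkcond -natz natr_prod -big_split /=.
    apply: eq_bigr => i _; have := leJa i; rewrite mnmBE mnmE.
    case: (i \in J) => /= ai; last by rewrite subn0 mul1r natz.
    by rewrite subn1 -lt0n ai muln1 mulN1r natz.
  rewrite -ltnNge => lti; rewrite (bigD1 i) //=.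
  move: lti; rewrite mnmE; case: (i \in J) => //.
  by rewrite ltnS leqn0 => ->; rewrite muln0 oppr0 mul0r.
by apply: eq_bigr => i _; rewrite addrC.
Qed.

End CoefMulSeries.

(** * Krull dimension *)

Section PrimeChains.
Variables (k : fieldType) (S : comAlgType k).

Lemma is_idealZ (P : S -> Prop) (c : k) a : is_ideal P -> P a -> P (c *: a).
Proof. by case=> _ _ PM Pa; rewrite -mulr_algl; apply: PM. Qed.

Lemma is_ideal_sum (P : S -> Prop) (J : Type) (r : seq J) (B : pred J)
    (F : J -> S) :
  is_ideal P -> (forall j, B j -> P (F j)) -> P (\sum_(j <- r | B j) F j).
Proof. by case=> P0 PD _ PF; apply: big_ind. Qed.

Lemma prime_ideal_expr (P : S -> Prop) a m :
  is_prime_ideal P -> P (a ^+ m) -> P a.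
Proof.
case=> _ P1 Pprime; elim: m => [/P1 //|m IHm].
by rewrite exprS => /Pprime[].
Qed.

Lemma is_ideal_addI (P : S -> Prop) a b : is_ideal P -> P (a + b) -> P b -> P a.
Proof.
case=> _ PD PM Pab Pb; rewrite -[a](addrK b) -[- b]mulN1r.
by apply: PD => //; apply: PM.
Qed.

(** Exponents are lists, so that an induction along a chain can split off [a 0] and shift the
    sequence. *)
Fixpoint seq_monomial (a : nat -> S) (m : seq nat) : S :=
  if m is j :: m' then a 0%N ^+ j * seq_monomial (fun i => a i.+1) m' else 1.

Fixpoint exponent_box (N e : nat) : seq (seq nat) :=
  if e is e'.+1 then [seq j :: m | j <- iota 0 N, m <- exponent_box N e']
  else [:: [::]].

Lemma size_exponent_box N e : size (exponent_box N e) = (N ^ e)%N.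
Proof. by elim: e => //= e IHe; rewrite size_allpairs size_iota IHe expnS. Qed.

Lemma exponent_box_uniq N e : uniq (exponent_box N e).
Proof.
elim: e => //= e IHe; apply: allpairs_uniq => //; first exact: iota_uniq.
by move=> [j m] [j' m'] _ _ /= [-> ->].
Qed.

Lemma mem_exponent_box N e m :
  m \in exponent_box N e -> size m = e /\ all (fun j => j < N)%N m.
Proof.
elim: e m => [|e IHe] m /=; first by rewrite inE => /eqP ->.
case/allpairsP=> -[j m'] /= [+ /IHe[<- ltm'] ->].
by rewrite mem_iota add0n /= => ->.
Qed.

(* Look at the lexicographically smallest exponent of a relation: dividing by
   the power of [a 0], which is not in [P 0], and reducing modulo [P 1], which
   contains [a 0], leaves a relation between [a 1], [a 2], ... modulo [P 1]. *)
Lemma prime_chain_independent N e (P : nat -> S -> Prop) (a : nat -> S)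
    (c : seq nat -> k) :
  (forall i, (i <= e)%N -> is_prime_ideal (P i)) ->
  (forall i, (i < e)%N -> [/\ forall b, P i b -> P i.+1 b,
                              P i.+1 (a i) & ~ P i (a i)]) ->
  P 0%N (\sum_(m <- exponent_box N e) c m *: seq_monomial a m) ->
  {in exponent_box N e, forall m, c m = 0}.
Proof.
elim: e P a c => [|e IHe] P a c Pprime Pchain.
  rewrite /= big_seq1 => Pc m; rewrite inE => /eqP ->; apply/eqP.
  have [P0i P1 _] := Pprime 0%N (leqnn 0).
  apply/negPn/negP=> c_neq0; apply: P1.
  have := is_idealZ (c [::])^-1 P0i Pc.
  by rewrite scalerA mulVf // scale1r.
pose r j := \sum_(m <- exponent_box N e)
  c (j :: m) *: seq_monomial (fun i => a i.+1) m.
have P0p := Pprime 0%N isT; have P1p := Pprime 1%N isT.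
have [P0i _ P0M] := P0p; have [P1i _ _] := P1p.
have [P01 P1a P0a] := Pchain 0%N isT.
rewrite /= big_allpairs_dep /=.
under eq_bigr => j _.
  under eq_bigr => m _ do rewrite scalerAr.
  rewrite -mulr_sumr -/(r j); over.
move=> Psum.
suff c0 j : (j < N)%N -> {in exponent_box N e, forall m, c (j :: m) = 0}.
  move=> m /allpairsP[[j m'] /= [+ m'b ->]].
  by rewrite mem_iota add0n /= => ltj; apply: c0.
elim/ltn_ind: j => j IHj ltjN; apply: (IHe (fun i => P i.+1) (fun i => a i.+1)).
- by move=> i lei; apply: Pprime.
- by move=> i lti; apply: Pchain.
have {}Psum : P 0%N (a 0%N ^+ j *
    (r j + \sum_(j.+1 <= i < N) a 0%N ^+ (i - j) * r i)).
  suff <- : \sum_(i <- iota 0 N) a 0%N ^+ i * r i =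
      a 0%N ^+ j * (r j + \sum_(j.+1 <= i < N) a 0%N ^+ (i - j) * r i) by [].
  rewrite -{1}[N]subn0 -/(index_iota 0 N).
  rewrite (big_cat_nat (leq0n j) (ltnW ltjN)) /= big_nat big1
    => [|i /andP[_ ltij]].
    rewrite add0r big_ltn // mulrDr [X in _ = _ + X]mulr_sumr; congr (_ + _).
    rewrite big_nat [RHS]big_nat; apply: eq_bigr => i /andP[ltji _].
    by rewrite mulrA -exprD subnKC // ltnW.
  rewrite /r big_seq big1 ?mulr0 // => m mb.
  by rewrite IHj ?scale0r // (ltn_trans ltij).
case/P0M: Psum => [/(prime_ideal_expr P0p)/P0a // |/P01].
move/(is_ideal_addI P1i); apply; rewrite big_nat.
apply: is_ideal_sum => // i /andP[ltji _]; rewrite -(subnSK ltji) exprS.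
by case: P1i => _ _ PM; rewrite -mulrA mulrC; apply: PM.
Qed.

End PrimeChains.

Section KrullDimension.
Variables (k : fieldType) (n : nat).
Implicit Types (Z : {set 'I_n}) (p q : {mpoly k[n]}).

Definition avoids Z (m : 'X_{1..n}) := [forall i in Z, m i == 0%N].

Lemma is_ideal_avoids (P : {mpoly k[n]} -> Prop) Z p :
  is_ideal P -> (forall i, i \in Z -> P 'X_i) ->
  {in msupp p, forall m, ~~ avoids Z m} -> P p.
Proof.
move=> Pid PZ hp; rewrite [p]mpolyE big_seq.
apply: is_ideal_sum => // m /hp; rewrite negb_forall_in => /exists_inP[i Zi mi].
apply: is_idealZ => //; have le : (U_(i) <= m)%MM by rewrite lep1mP.
by rewrite -(submK le) mpolyXD; case: Pid => _ _; apply; apply: PZ.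
Qed.

Definition max_deg (d : nat) p := {in msupp p, forall m, mdeg m <= d}%N.

Lemma max_deg1 : max_deg 0 1.
Proof. by move=> m; rewrite -mpolyC1 msupp1 inE => /eqP ->; rewrite mdeg0. Qed.

Lemma max_degM d e p q : max_deg d p -> max_deg e q -> max_deg (d + e) (p * q).
Proof.
move=> hp hq m /msuppM_le/allpairsP[[m1 m2] /= [/hp h1 /hq h2 ->]].
by rewrite mdegD leq_add.
Qed.

Lemma max_degX d p j : max_deg d p -> max_deg (d * j) (p ^+ j).
Proof.
move=> hp; elim: j => [|j IHj]; first by rewrite muln0; apply: max_deg1.
by rewrite exprS mulnS; apply: max_degM.
Qed.

Lemma max_deg_seq_monomial d (a : nat -> {mpoly k[n]}) m :
  (forall i, max_deg d (a i)) -> max_deg (d * sumn m) (seq_monomial a m).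
Proof.
elim: m a => [|j m IHm] a ha /=; first by rewrite muln0; apply: max_deg1.
by rewrite mulnDr; apply: max_degM; [apply: max_degX | apply: IHm].
Qed.

(** Bounding each exponent by [M], rather than the total degree, gives a family that is easy to
    count and still contains all monomials of degree at most [M] avoiding [Z]. *)
Definition avoiding_mnm Z M (g : {ffun {i | i \notin Z} -> 'I_M.+1}) : 'X_{1..n} :=
  [multinom if insub i is Some w then val (g w) else 0%N | i < n].

Lemma avoiding_mnmP Z M (m : 'X_{1..n}) :
  avoids Z m -> (mdeg m <= M)%N ->
  exists g : {ffun {i | i \notin Z} -> 'I_M.+1}, m = avoiding_mnm g.
Proof.
move=> /forall_inP Zm lemM; exists [ffun w => inord (m (val w))].
apply/mnmP => i; rewrite mnmE; case: insubP => [w _ <-|].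
  rewrite ffunE /= inordK // ltnS (leq_trans _ lemM) // mdegE.
  by rewrite (bigD1 (val w)) //= leq_addr.
by rewrite negbK => /Zm/eqP.
Qed.

Lemma card_avoiding_mnm Z M :
  #|{: {ffun {i | i \notin Z} -> 'I_M.+1}}| = (M.+1 ^ (n - #|Z|))%N.
Proof.
rewrite card_ffun card_ord card_sig; congr (_ ^ _)%N.
have -> : (n - #|Z|)%N = #|~: Z| by rewrite [RHS]cardsCs setCK card_ord.
by apply: eq_card => i; rewrite !inE.
Qed.

(** With [C = D * e + 1] and [N = C ^ d + 1], the left side is at most
    [C ^ d * N ^ d < N ^ d.+1 <= N ^ e]. *)
Lemma box_count_lt d e D : (d < e)%N ->
  exists N, ((D * (e * N)).+1 ^ d < N ^ e)%N.
Proof.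
move=> ltde; pose C := (D * e).+1; exists (C ^ d).+1.
set N := (C ^ d).+1.
have le_exp x y : (x <= y -> x ^ d <= y ^ d)%N.
  by move=> lexy; case: (posnP d) => [-> //|d_gt0]; rewrite leq_exp2r.
apply: (@leq_ltn_trans ((C * N) ^ d)).
  by apply: le_exp; rewrite mulSn mulnA addSn ltnS leq_addl.
rewrite expnMn; apply: (@leq_trans (N ^ d.+1)); last by rewrite leq_pexp2l.
by rewrite expnS ltn_pmul2r // expn_gt0.
Qed.

(* The [N ^ e] monomials with exponents below [N] in [e] given elements have
   degree [O(N)], while there are only [O(N ^ (n - #|Z|))] monomials of that
   degree avoiding [Z]. *)
Lemma algebraic_dependence Z e (a : nat -> {mpoly k[n]}) D :
  (forall i, max_deg D (a i)) -> (n - #|Z| < e)%N ->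
  exists N (c : seq nat -> k),
    (exists2 m, m \in exponent_box N e & c m != 0) /\
    {in msupp (\sum_(m <- exponent_box N e) c m *: seq_monomial a m),
       forall m, ~~ avoids Z m}.
Proof.
move=> ha /(@box_count_lt _ _ D)[N ltN]; set M := (D * (e * N))%N in ltN.
rewrite -card_avoiding_mnm -size_exponent_box in ltN.
pose mon r := seq_monomial a (nth [::] (exponent_box N e) r).
pose A : 'M[k]_(_, _) := \matrix_(r < size (exponent_box N e),
  j < #|{: {ffun {i | i \notin Z} -> 'I_M.+1}}|)
  (mon r)@_(avoiding_mnm (enum_val j)).
have [u u_neq0 uA0] := exists_row_kernel A ltN.
have [r ur] := rV0Pn _ u_neq0.
pose c m := if insub (index m (exponent_box N e)) is Some r then u ord0 r else 0.
have cE r' : c (nth [::] (exponent_box N e) (val r')) = u ord0 r'.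
  by rewrite /c index_uniq ?exponent_box_uniq ?ltn_ord // valK.
exists N, c; split.
  by exists (nth [::] (exponent_box N e) r); rewrite ?mem_nth ?cE.
set q := \sum_(m <- _) _.
have qE : q = \sum_(r < size (exponent_box N e)) u ord0 r *: mon r.
  by rewrite /q (big_nth [::]) big_mkord; apply: eq_bigr => r' _; rewrite cE.
move=> m; apply: contraL => Zm; rewrite -mcoeff_eq0; apply/eqP.
(* A monomial of degree above [M] occurs in no product from the box; any other one avoiding [Z]
   labels a column of [A], which [u] kills. *)
have [ltMm|lemM] := ltnP M (mdeg m).
  rewrite qE linear_sum /= big1 // => r' _; rewrite mcoeffZ.
  rewrite memN_msupp_eq0 ?mulr0 //; apply/negP.
  have /mem_exponent_box[sz lt] := mem_nth [::] (ltn_ord r').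
  move/(max_deg_seq_monomial ha); rewrite leqNgt => /negP; apply.
  apply: leq_ltn_trans ltMm; rewrite leq_mul2l; apply/orP; right.
  suff le s : all (fun j => j < N)%N s -> (sumn s <= size s * N)%N.
    by rewrite -[e in (e * N)%N]sz; apply: le.
  elim: s => //= j s IHs /andP[ltj /IHs le].
  by rewrite mulSn leq_add // ltnW.
have [g ->] := avoiding_mnmP Zm lemM.
move/rowP: uA0 => /(_ (enum_rank g)); rewrite !mxE qE linear_sum /= => uA0.
rewrite -[RHS]uA0; apply: eq_bigr => r' _.
by rewrite mcoeffZ mxE enum_rankK.
Qed.

Lemma prime_chain_leq Z e
    (P : 'I_e.+1 -> {mpoly k[n]} -> Prop) :
  (forall i, is_prime_ideal (P i)) ->
  (forall i j : 'I_e.+1, (i < j)%N ->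
     (forall a, P i a -> P j a) /\ (exists a, P j a /\ ~ P i a)) ->
  (forall i, i \in Z -> P ord0 'X_i) -> (e <= n - #|Z|)%N.
Proof.
move=> Pprime Pchain PZ; rewrite leqNgt; apply/negP => lt_e.
have [a0 Ha0] : exists a : 'I_e -> {mpoly k[n]}, forall i : 'I_e,
    P (inord i.+1) (a i) /\ ~ P (inord i) (a i).
  apply: (fin_all_exists (P := fun (i : 'I_e) a =>
     P (inord i.+1) a /\ ~ P (inord i) a)) => i.
  by case: (Pchain (inord i) (inord i.+1)); rewrite ?inordK // ltnS // ltnW.
pose a i : {mpoly k[n]} := if insub i is Some j then a0 j else 0.
have aE (j : 'I_e) : a j = a0 j by rewrite /a valK.
pose D := (\max_(i < e) msize (a0 i))%N.
have aD i : max_deg D (a i).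
  rewrite /a; case: insubP => [j _ _|_] m; last by rewrite msupp0.
  by move/msize_mdeg_lt/ltnW => le; apply: leq_trans le _; apply: leq_bigmax.
have [N [c [[m mbox cm] qZ]]] := algebraic_dependence aD lt_e.
case/eqP: cm; move: m mbox.
apply: (prime_chain_independent (P := fun i => P (inord i)) (a := a)) => //.
- move=> i lti; rewrite -[i]/(val (Ordinal lti)) aE.
  split; try by case: (Ha0 (Ordinal lti)).
  by case: (Pchain (inord i) (inord i.+1)) => //; rewrite ?inordK // ltnS // ltnW.
- apply: is_ideal_avoids qZ; first by case: (Pprime (inord 0)).
  have -> : inord 0 = ord0 :> 'I_e.+1 by apply: val_inj; rewrite /= inordK.
  exact: PZ.
Qed.

Local Notation kill_vars Z :=
  (comp_mpoly [tuple if i \in Z then 0 else 'X_i : {mpoly k[n]} | i < n]).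

Lemma kill_varsX Z i : kill_vars Z 'X_i = if i \in Z then 0 else 'X_i.
Proof. by rewrite comp_mpolyXU -tnth_nth tnth_mktuple. Qed.

(** The kernel of a ring morphism into an integral domain is prime; this one is the ideal generated
    by the variables of [Z]. *)
Lemma kill_vars_prime Z : is_prime_ideal (fun p => kill_vars Z p = 0).
Proof.
split; first split.
- exact: rmorph0.
- by move=> a b ea eb; rewrite rmorphD /= ea eb addr0.
- by move=> a b eb; rewrite rmorphM /= eb mulr0.
- by rewrite rmorph1; apply/eqP/oner_neq0.
- move=> a b; rewrite rmorphM => /eqP; rewrite mulf_eq0.
  by case/orP=> /eqP; [left | right].
Qed.

Lemma kill_vars_monomial Z m :
  kill_vars Z 'X_[m] = if avoids Z m then 'X_[m] else 0.
Proof.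
rewrite mpolyXE_id rmorph_prod /=; case: ifP => [/forall_inP Zm|/negbT].
  apply: eq_bigr => i _; rewrite rmorphXn /= kill_varsX.
  by case: ifP => // /Zm/eqP ->.
rewrite negb_forall_in => /exists_inP[i Zi mi]; rewrite (bigD1 i) //=.
by rewrite rmorphXn /= kill_varsX Zi expr0n (negPf mi) mul0r.
Qed.

Lemma kill_vars_sub Z Z' p :
  Z \subset Z' -> kill_vars Z' (kill_vars Z p) = kill_vars Z' p.
Proof.
move=> sZ; elim/mpolyind: p => [|c m p _ _ IHp]; first by rewrite !comp_mpoly0.
rewrite !(comp_mpolyD, comp_mpolyZ) IHp; congr (_ *: _ + _).
rewrite kill_vars_monomial.
case: ifP => // /negbT; rewrite negb_forall_in => /exists_inP[i Zi mi].
rewrite comp_mpoly0 kill_vars_monomial ifF //; apply/negbTE.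
by rewrite negb_forall_in; apply/exists_inP; exists i; rewrite ?(subsetP sZ).
Qed.

(** The variables outside [Z] are killed one at a time, in the order of [s]. *)
Lemma kill_vars_chain (I : {mpoly k[n]} -> Prop) Z :
  (forall p, I p -> {in msupp p, forall m, ~~ avoids Z m}) ->
  has_prime_chain I (n - #|Z|).
Proof.
move=> IZ; pose s := enum (~: Z).
have sz : size s = (n - #|Z|)%N by rewrite -cardE cardsCs setCK card_ord.
have lei (i : 'I_(n - #|Z|).+1) : (i <= size s)%N by rewrite sz -ltnS.
pose W (i : 'I_(n - #|Z|).+1) := Z :|: [set j in take i s].
exists (fun i p => kill_vars (W i) p = 0); split=> [i|i a Ia|i j ltij].
- exact: kill_vars_prime.
- apply: (is_ideal_avoids (P := fun p => kill_vars (W i) p = 0)) (IZ a Ia).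
    by case: (kill_vars_prime (W i)).
  by move=> l Zl; rewrite kill_varsX inE Zl.
- split=> [a ka|].
    rewrite -(@kill_vars_sub (W i)) ?ka ?comp_mpoly0 // setUS //.
    by apply/subsetP => l; rewrite !inE !in_take_leq ?lei // => /ltn_trans; apply.
  have lt_is : (i < size s)%N by rewrite sz (leq_trans ltij) // -ltnS.
  (* The variable at position [i] of [s] is killed at stage [j] but not yet at stage [i]. *)
  pose l := tnth (in_tuple s) (Ordinal lt_is).
  have ls : l \in s by apply: mem_tnth.
  have il : index l s = i by rewrite /l (tnth_nth l) index_uniq ?enum_uniq.
  have Zl : l \notin Z by move: ls; rewrite mem_enum inE.
  exists 'X_l; rewrite !kill_varsX !inE !in_take_leq ?lei // il ltij (negPf Zl).
  rewrite ltnn /=; split=> // /eqP; apply/negP; rewrite -msupp_eq0 msuppX.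
  by [].
Qed.

End KrullDimension.

(** * Partitioned complexes *)

(** The coefficients of [(1 - 'X) * q] are successive differences of those of [q], so their
    vanishing below [N] passes to [q] from the bottom up. *)
Lemma coef_1BX_exp_cancel N r (q : {poly int}) :
  (forall i, (i < N)%N -> ((1 - 'X) ^+ r * q)`_i = 0) ->
  forall i, (i < N)%N -> q`_i = 0.
Proof.
elim: r q => [|r IHr] q; first by rewrite expr0 mul1r.
rewrite exprSr -mulrA => /IHr {IHr} q0.
elim=> [|i IHi] lti; have := q0 _ lti;
  rewrite mulrBl mul1r coefB coefXM /= ?subr0 //.
by rewrite IHi ?subr0 // ltnW.
Qed.

Section Specialization.
Variable n : nat.

Definition spec (p : {mpoly int[n]}) : {poly int} := mmap polyC (fun=> 'X) p.

Lemma specE p : spec p = \sum_(m <- msupp p) p@_m *: 'X^(mdeg m).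
Proof.
apply: eq_bigr => m _; rewrite mul_polyC /mmap1; congr (_ *: _).
by rewrite prodrXr mdegE.
Qed.

Lemma spec_prod1B (A : {set 'I_n}) :
  spec (\prod_(i in A) (1 - 'X_i)) = (1 - 'X) ^+ #|A|.
Proof.
rewrite /spec rmorph_prod /= -prodr_const; apply: eq_bigr => i _.
by rewrite rmorphB rmorph1 /= mmapX mmap1U.
Qed.

Lemma spec_prodX (A : {set 'I_n}) : spec (\prod_(i in A) 'X_i) = 'X^#|A|.
Proof.
rewrite /spec rmorph_prod /= -prodr_const; apply: eq_bigr => i _.
by rewrite mmapX mmap1U.
Qed.

Lemma coef_spec_eq0 p N : (forall m, (mdeg m < N)%N -> p@_m = 0) ->
  forall i, (i < N)%N -> (spec p)`_i = 0.
Proof.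
move=> p0 i ltiN; rewrite specE coef_sum big1 // => m _.
rewrite coefZ coefXn; case: eqP => [e|]; last by rewrite mulr0.
by rewrite p0 ?mul0r // -e.
Qed.

Lemma coef_spec_trunc (face : pred 'X_{1..n}) N j :
  (spec (trunc_series (fun m => face m) N))`_j = #|faces_of_deg face N j|%:Z.
Proof.
rewrite /spec raddf_sum coef_sum -sum1_card -natz natr_sum /=.
rewrite [RHS]big_mkcond; apply: eq_bigr => m _.
rewrite mmapZ mmapX mul_polyC coefZ /mmap1 prodrXr -mdegE coefXn inE eq_sym.
by case: eqP; case: (face m).
Qed.

End Specialization.

(* A pure simplicial complex on the ground set ['I_n], with facets the
   complements of the sets [cf f], together with a partition of its faces into
   the intervals from [up f] to the complement of [cf f]. *)
Section PartitionedComplex.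
Variables (k : fieldType) (n : nat) (F : finType) (T : {set F}).
Variables (cf up : F -> {set 'I_n}) (r : nat) (I : {mpoly k[n]} -> Prop).
Hypothesis cf_up : {in T, forall f, [disjoint cf f & up f]}.
Hypothesis card_cf : {in T, forall f, #|cf f| = r}.
Hypothesis card_intervals : forall A : {set 'I_n},
  #|[set f in T | (up f \subset A) && [disjoint A & cf f]]| =
  [exists f in T, [disjoint A & cf f]] :> nat.

Let face (m : 'X_{1..n}) := [exists f in T, avoids (cf f) m].
Hypothesis I_msupp : forall p, I p <-> {in msupp p, forall m, ~~ face m}.

Definition K_summand f : {mpoly int[n]} :=
  \prod_(i in cf f) (1 - 'X_i) * \prod_(i in up f) 'X_i.

(** Lying in the interval of [f] is a separate condition on each exponent, so its indicator is a
    product over the variables. *)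
Let chi f (i : 'I_n) (c : nat) : nat :=
  if i \in cf f then c == 0%N else if i \in up f then c != 0%N else true.

(** By [card_intervals], the support of [m] lies in one interval if [m] is a face and in none
    otherwise. *)
Let face_sum m : nat_of_bool (face m) = (\sum_(f in T) \prod_i chi f i (m i))%N.
Proof.
pose A := [set i | m i != 0%N].
have avA Z : avoids Z m = [disjoint A & Z].
  rewrite disjoint_sym disjoint_subset; apply/forall_inP/subsetP => h i Zi.
    by rewrite !inE negbK h.
  by have := h i Zi; rewrite !inE negbK.
have -> : face m = [exists f in T, [disjoint A & cf f]].
  by apply: eq_existsb => f; rewrite avA.
rewrite -card_intervals -sum1_card big_mkcond [RHS]big_mkcond /=.
apply: eq_bigr => f _; rewrite inE; case: ifP => [/andP[-> /andP[sA dA]]|].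
  rewrite big1 // => i _; rewrite /chi; case: ifP => [cfi|_].
    by have := disjointFl dA cfi; rewrite inE => /negbFE ->.
  by case: ifP => // /(subsetP sA); rewrite inE => ->.
case: (boolP (f \in T)) => //= fT /negbT; rewrite negb_and.
case/orP=> [/subsetPn[i upi Ai]|].
  rewrite (bigD1 i) //= /chi upi; move: Ai; rewrite inE negbK => /eqP ->.
  by rewrite (disjointFl (cf_up fT) upi).
rewrite -setI_eq0 => /set0Pn[i]; rewrite !inE => /andP[mi cfi].
by rewrite (bigD1 i) //= /chi cfi (negPf mi).
Qed.

(** Multiplication by [1 - t_i] turns the three possible series of [chi f i], namely [1],
    [t_i / (1 - t_i)] and [1 / (1 - t_i)], into [1 - t_i], [t_i] and [1]. *)
Let coef_mul_face_series a :
  coef_mul_series (\prod_(i < n) (1 - 'X_i)) (fun m => nat_of_bool (face m)) a =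
  (\sum_(f in T) K_summand f)@_a.
Proof.
rewrite (eq_coef_mul_series _ _ face_sum) coef_mul_series_sum linear_sum /=.
apply: eq_bigr => f fT; rewrite coef_mul_series_prod.
pose al i : int := if i \in cf f then 1 else if i \in up f then 0 else 1.
pose be i : int := if i \in cf f then -1 else if i \in up f then 1 else 0.
have -> : K_summand f = \prod_i ((be i)%:MP * 'X_i + (al i)%:MP).
  rewrite /K_summand big_mkcond [X in _ * X]big_mkcond -big_split /=.
  apply: eq_bigr => i _; rewrite /al /be; case: (boolP (i \in cf f)) => cfi.
    by rewrite (disjointFr (cf_up fT) cfi) mulr1 mpolyCN mpolyC1 mulN1r addrC.
  case: ifP => _; rewrite !(mpolyC0, mpolyC1) !mul1r ?addr0 //.
  by rewrite mul0r add0r.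
rewrite mcoeff_prod_linear; apply: eq_bigr => i _; rewrite /chi /al /be.
by case: (i \in cf f); case: (i \in up f); case: (a i) => [|[|c]].
Qed.

Theorem is_K_polynomialP K :
  is_K_polynomial I K <-> K = \sum_(f in T) K_summand f.
Proof.
split=> [[H /(hilbert_function_fineP I_msupp) hH KE]|->].
  by apply/mpolyP => a; rewrite KE (eq_coef_mul_series _ _ hH) coef_mul_face_series.
exists (fun m => nat_of_bool (face m)); first exact/(hilbert_function_fineP I_msupp).
by move=> a; rewrite coef_mul_face_series.
Qed.

(** The product of the variables outside [P] is not in [P], hence not in [I]. So it is a face
    monomial avoiding some [cf f], whose variables then all lie in [P]. *)
Let prime_contains_cf (P : {mpoly k[n]} -> Prop) :
  is_prime_ideal P -> (forall p, I p -> P p) ->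
  exists2 f, f \in T & forall i, i \in cf f -> P 'X_i.
Proof.
move=> [Pid P1 Pprime] IP.
(* Excluded middle makes membership boolean, so that the set of variables outside [P] can be
   formed. *)
have [b bP] : exists b : 'I_n -> bool, forall i, P 'X_i <-> b i.
  apply: (fin_all_exists (P := fun i (b : bool) => P 'X_i <-> b)) => i.
  by case: (classic (P 'X_i)) => h; [exists true | exists false].
pose m := mnm_ind [set i | ~~ b i].
have : face m.
  case: (boolP (face m)) => // fm; exfalso.
  have : P 'X_[m] by apply: IP; apply/I_msupp => m' /mem_msuppXP <-.
  rewrite mpolyX_ind; apply: (big_ind (fun p => ~ P p)) => //.
    by move=> x y Px Py /Pprime[].
  by move=> i; rewrite inE => /negP nb /bP.
case/exists_inP=> f fT /forall_inP avf; exists f => // i /avf.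
by rewrite mnmE inE eqb0 negbK => /bP.
Qed.

(** Since all [cf f] have size [r], the chain built from any one of them attains the upper bound. *)
Lemma krull_dim_partitioned f : f \in T -> krull_dim_quot I (n - r).
Proof.
move=> fT; split=> [|e [P [Pprime IP Pchain]]].
  rewrite -(card_cf fT); apply: kill_vars_chain => p /I_msupp Ip m /Ip.
  by apply: contra => av; apply/exists_inP; exists f.
have [g gT gP] := prime_contains_cf (Pprime ord0) (IP ord0).
by rewrite -(card_cf gT); apply: prime_chain_leq gP.
Qed.

Let h_of (H : nat -> nat) d j : int :=
  \sum_(i < j.+1) ((1 - 'X) ^+ d : {poly int})`_i * (H (j - i)%N)%:Z.

(** Below degree [N = j + 1], [(1 - t)^n] times the Hilbert series is the specialized K-polynomial,
    that is [(1 - t)^r] times the sum of the [t^#|up f|]. *)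
Let h_partitioned H f j : f \in T -> hilbert_function (@mdeg n) I H ->
  h_of H (n - r) j = #|[set f in T | #|up f| == j]|%:Z.
Proof.
move=> fT hH; pose N := j.+1.
have ler : (r <= n)%N by rewrite -(card_cf fT) -[X in (_ <= X)%N]card_ord max_card.
pose ser := trunc_series (fun m => nat_of_bool (face m)) N.
pose D : {mpoly int[n]} := \prod_(i < n) (1 - 'X_i).
pose K := \sum_(f in T) K_summand f.
have spec0 : forall i, (i < N)%N -> (spec (D * ser - K))`_i = 0.
  apply: coef_spec_eq0 => m ltm; rewrite mcoeffB -coef_mul_seriesE //.
  by rewrite coef_mul_face_series subrr.
pose up_poly : {poly int} := \sum_(f in T) 'X^#|up f|.
have specK : spec K = (1 - 'X) ^+ r * up_poly.
  rewrite /spec raddf_sum mulr_sumr; apply: eq_bigr => g gT /=.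
  by rewrite rmorphM /= -!/(spec _) spec_prod1B spec_prodX card_cf.
have specD : spec D = (1 - 'X) ^+ n.
  have -> : D = \prod_(i in [set: 'I_n]) (1 - 'X_i).
    by apply: eq_bigl => i; rewrite inE.
  by rewrite spec_prod1B cardsT card_ord.
have {}spec0 : forall i, (i < N)%N ->
    ((1 - 'X) ^+ r * ((1 - 'X) ^+ (n - r) * spec ser - up_poly))`_i = 0.
  move=> i /spec0; rewrite /spec rmorphB rmorphM /= -!/(spec _) specD specK.
  by rewrite mulrBr mulrA -exprD subnKC.
have := coef_1BX_exp_cancel spec0 (ltnSn j).
rewrite coefB => /eqP; rewrite subr_eq0 coefM => /eqP hE.
transitivity (up_poly`_j).
  rewrite -hE; apply: eq_bigr => i _; rewrite coef_spec_trunc.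
  by rewrite (hilbert_function_mdegE I_msupp (N := N) hH) // ltnS leq_subr.
rewrite coef_sum -sum1_card -natz natr_sum /= big_mkcond [RHS]big_mkcond /=.
apply: eq_bigr => g _; rewrite inE coefXn eq_sym.
by case: (g \in T) => //=; case: eqP.
Qed.

Let I_unit : I 1 <-> T = set0.
Proof.
have face0 f : f \in T -> face 0%MM.
  by move=> fT; apply/exists_inP; exists f => //; apply/forall_inP => i; rewrite mnm0E.
rewrite I_msupp -mpolyC1 msupp1; split=> [h|T0 m _].
  apply/setP => f; rewrite inE; apply/negP => /face0; apply/negP.
  by apply: h; rewrite inE.
by apply/exists_inP => -[f]; rewrite T0 inE.
Qed.

Theorem h_vector_exists : exists h, is_h_vector I h.
Proof.
have [T0|[f fT]] := set_0Vmem T; first by exists [::]; left; split=> //; apply/I_unit.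
pose H j := #|faces_of_deg face j.+1 j|.
have hH : hilbert_function (@mdeg n) I H := hilbert_function_mdeg I_msupp.
exists (mkseq (h_of H (n - r)) (n - r).+1); right.
exists (n - r)%N, H; split=> //; first exact: krull_dim_partitioned fT.
  by rewrite size_mkseq.
move=> j; have [ltj|lej] := ltnP j (n - r).+1; first by rewrite nth_mkseq.
(* Past position [n - r] the list defaults to [0]; so does the count, as [up g] is disjoint from
   [cf g], which has size [r]. *)
rewrite nth_default ?size_mkseq // -/(h_of H (n - r) j) (h_partitioned j fT hH).
rewrite (_ : [set _ in T | _] = set0) ?cards0 //; apply/setP => g; rewrite !inE.
apply/negP => /andP[gT /eqP upg]; move: lej; rewrite -upg ltnNge => /negP; apply.
have le : (r + #|up g| <= n)%N.
  rewrite -(card_cf gT) -cardsUI (disjoint_setI0 (cf_up gT)) cards0 addn0.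
  by rewrite -[X in (_ <= X)%N]card_ord max_card.
by rewrite leq_subRL // (leq_trans (leq_addr _ _) le).
Qed.

Theorem h_vectorE h j :
  is_h_vector I h -> h`_j = #|[set f in T | #|up f| == j]|%:Z.
Proof.
case=> [[/I_unit T0 ->]|[d [H [Kd hH _ hE]]]].
  rewrite nth_nil (_ : [set _ in T | _] = set0) ?cards0 //.
  by apply/setP => g; rewrite T0 !inE.
(* An empty [T] makes [I] the unit ideal, which no prime contains, so that there is no Krull
   dimension. *)
have [T0|[f fT]] := set_0Vmem T.
  case: Kd => -[P [Pprime IP _]] _; case: (Pprime ord0) => _ [].
  exact/IP/I_unit.
have Kd' := krull_dim_partitioned fT.
have dE : d = (n - r)%N.
  by apply/eqP; rewrite eqn_leq (proj2 Kd' d (proj1 Kd)) (proj2 Kd _ (proj1 Kd')).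
by rewrite hE dE -/(h_of H (n - r) j) (h_partitioned j fT hH).
Qed.

End PartitionedComplex.

(** * Tableaux *)

Lemma graphP (X Y : finType) (f : {ffun X -> Y}) x y :
  ((x, y) \in graph f) = (y == f x).
Proof.
by apply/imsetP/eqP => [[x' _ [-> ->]] // | ->]; exists x.
Qed.

Lemma graph_subP (X Y : finType) (f : {ffun X -> Y}) (F : {set X * Y}) :
  reflect (forall x, (x, f x) \in F) (graph f \subset F).
Proof.
apply: (iffP subsetP) => [h x|h [x y]]; first by apply: h; rewrite graphP.
by rewrite graphP => /eqP ->.
Qed.

Section PosetTableaux.
Variables (dX dY : Order.disp_t) (X : finPOrderType dX) (Y : finPOrderType dY).
Variables (Y_ : X -> {set Y}) (Psi : {set X * X}).
Hypothesis hY : forall x, {in Y_ x &, total (@Order.le dY Y)}.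
Hypothesis hPsi : forall x1 x2, (x1, x2) \in Psi -> (x1 < x2)%O.

Local Notation T := (poset_tableaux Y_ Psi).
Implicit Types (f g : {ffun X -> Y}) (F : {set X * Y}).

Lemma poset_tableauxP f :
  reflect [/\ forall x, f x \in Y_ x,
              forall x1 x2, (x1 <= x2)%O -> (f x1 <= f x2)%O &
              forall x1 x2, (x1, x2) \in Psi -> (f x1 < f x2)%O] (f \in T).
Proof.
rewrite inE; apply: (iffP and3P) => -[h1 h2 h3]; split.
- exact/forallP.
- by move=> x1 x2; apply/implyP; move/forallP: h2 => /(_ x1)/forallP/(_ x2).
- by move=> x1 x2; apply/implyP; move/forallP: h3 => /(_ x1)/forallP/(_ x2).
- exact/forallP.
- by apply/forallP => x1; apply/forallP => x2; apply/implyP; apply: h2.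
- by apply/forallP => x1; apply/forallP => x2; apply/implyP; apply: h3.
Qed.

Definition tab_max f g : {ffun X -> Y} := [ffun x => Order.max (f x) (g x)].

(** [Y] is only partially ordered, but [f x] and [g x] lie in the chain [Y_ x], where [Order.max] is
    a true maximum. *)
Lemma tab_maxP f g x : f \in T -> g \in T ->
  [/\ (f x <= tab_max f g x)%O, (g x <= tab_max f g x)%O &
      tab_max f g x = f x \/ tab_max f g x = g x].
Proof.
move=> /poset_tableauxP[Yf _ _] /poset_tableauxP[Yg _ _].
have /orP := hY (Yf x) (Yg x); rewrite ffunE maxEle.
by case: ifP => [le _|_ [//|le]]; split=> //; [right | left].
Qed.

(** The maximum at [x1] is the value of [f] or of [g]; that same tableau bounds it by its value at
    [x2], which is at most the maximum there. *)
Lemma tab_max_in f g : f \in T -> g \in T -> tab_max f g \in T.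
Proof.
move=> fT gT; have fgP x := tab_maxP x fT gT.
have /poset_tableauxP[Yf lef ltf] := fT; have /poset_tableauxP[Yg leg ltg] := gT.
apply/poset_tableauxP; split=> [x|x1 x2 le12|x1 x2 P12].
- by case: (fgP x) => _ _ [] ->.
- have [le1 le2 _] := fgP x2.
  by case: (fgP x1) => _ _ [] ->;
    [apply: le_trans le1 | apply: le_trans le2]; auto.
- have [le1 le2 _] := fgP x2.
  by case: (fgP x1) => _ _ [] ->;
    [apply: lt_le_trans le1 | apply: lt_le_trans le2]; auto.
Qed.

Lemma tab_max_graph f g F : f \in T -> g \in T -> graph f \subset F ->
  graph g \subset F -> graph (tab_max f g) \subset F.
Proof.
move=> fT gT /graph_subP fF /graph_subP gF; apply/graph_subP => x.
by have [_ _ [] ->] := tab_maxP x fT gT.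
Qed.

(** For [F] the complement of a face, this says that the face lies in the interval of [f]: it
    contains the vertices of [U_f] and none from the graph of [f]. *)
Definition locally_maximal F f :=
  (graph f \subset F) && [forall x, forall y in up_moves T f x, (x, y) \notin F].

(* Raising [f] to [g] at a maximal point [x] where they differ stays in [T]:
   the values of [f] above [x] are already those of [g]. *)
Lemma locally_maximal_top F f g : f \in T -> locally_maximal F f ->
  g \in T -> graph g \subset F -> (forall x, f x <= g x)%O -> f = g.
Proof.
move=> fT /andP[_ /forallP fmax] gT /graph_subP gF lefg.
have /poset_tableauxP[Yf lef ltf] := fT; have /poset_tableauxP[Yg leg ltg] := gT.
apply/ffunP => x0; apply/eqP/negPn/negP => x0P.
(* Minimising the number of points above [x], among those where [f] and [g] differ, yields a maximal
   such point. *)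
pose w (x : X) := #|[set z | (x < z)%O]|.
case: (@arg_minnP X x0 (fun x => f x != g x) w x0P) => x fgx xmin.
have eq_above z : (x < z)%O -> f z = g z.
  move=> ltxz; apply/eqP; apply: contraT => /xmin; rewrite leqNgt => /negP[].
  apply: proper_card; apply/properP; split.
    by apply/subsetP => t; rewrite !inE; apply: lt_trans.
  by exists z; rewrite !inE ?ltxx.
have ltfg : (f x < g x)%O by rewrite lt_neqAle fgx lefg.
have /forall_inP/(_ (g x)) := fmax x; rewrite inE ltfg gF /= => h.
apply: notF; apply: h; apply/poset_tableauxP; split=> [z|x1 x2 le12|x1 x2 P12].
- by rewrite ffunE; case: eqP => [->|_].
- rewrite !ffunE; case: eqP => [e1|/eqP n1]; case: eqP => [e2|/eqP n2] //.
  + by rewrite e1 in le12; rewrite eq_above ?leg // lt_neqAle eq_sym n2.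
  + by rewrite e2 in le12; apply: le_trans (lef _ _ le12) (lefg x).
  + exact: lef.
- rewrite !ffunE; case: eqP => [e1|/eqP n1]; case: eqP => [e2|/eqP n2].
  + by have := hPsi P12; rewrite e1 e2 ltxx.
  + by rewrite e1 in P12; rewrite eq_above ?ltg // hPsi.
  + by rewrite e2 in P12; apply: lt_trans (ltf _ _ P12) ltfg.
  + exact: ltf.
Qed.

(** Both equal their pointwise maximum, which is a tableau of [T] inside [F] above each of them. *)
Lemma locally_maximal_uniq F f g : f \in T -> locally_maximal F f ->
  g \in T -> locally_maximal F g -> f = g.
Proof.
move=> fT fm gT gm; have /andP[fF _] := fm; have /andP[gF _] := gm.
have mT := tab_max_in fT gT; have mF := tab_max_graph fT gT fF gF.
rewrite (locally_maximal_top fT fm mT mF) => [|x]; last by case: (tab_maxP x fT gT).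
rewrite -(locally_maximal_top gT gm mT mF) => [//|x].
by case: (tab_maxP x fT gT).
Qed.

(** Raising one value increases [w], the total number of elements below the values, so a maximiser
    of [w] among the tableaux inside [F] admits no raise there. *)
Lemma locally_maximal_exists F f : f \in T -> graph f \subset F ->
  exists2 g, g \in T & locally_maximal F g.
Proof.
move=> fT fF; pose w g := (\sum_x #|[set y | (y <= g x)%O]|)%N.
have fP : (f \in T) && (graph f \subset F) by rewrite fT.
case: (@arg_maxnP _ f (fun g => (g \in T) && (graph g \subset F)) w fP).
move=> g /andP[gT gF] gmax; exists g => //; rewrite /locally_maximal gF.
apply/forallP => x; apply/forall_inP => y; rewrite inE => /andP[lty chT].
apply/negP => xyF; have chF : graph (change g x y) \subset F.
  apply/graph_subP => z; rewrite ffunE; case: eqP => [->|_] //.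
  by move/graph_subP: gF.
have := gmax (change g x y); rewrite chT chF => /(_ isT) /=.
rewrite leqNgt => /negP; apply.
rewrite /w (bigD1 x) //= [X in (_ < X)%N](bigD1 x) //= -addSn.
apply: leq_add.
  apply: proper_card; apply/properP; rewrite ffunE eqxx; split.
    by apply/subsetP => z; rewrite !inE => /le_trans; apply; apply: ltW.
  by exists y; rewrite !inE // lt_geF.
by apply: leq_sum => z zx; rewrite ffunE (negPf zx).
Qed.

Lemma card_locally_maximal F :
  #|[set f in T | locally_maximal F f]| =
  [exists f in T, graph f \subset F] :> nat.
Proof.
case: exists_inP => [[f fT fF]|noF].
  have [g gT gm] := locally_maximal_exists fT fF.
  rewrite (_ : [set _ in T | _] = [set g]) ?cards1 //; apply/setP => g'.
  rewrite in_set1 in_set; apply/andP/eqP => [[g'T g'm]|->//].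
  exact: locally_maximal_uniq g'm gT gm.
apply/eqP; rewrite cards_eq0; apply/eqP/setP => f; rewrite in_set0 in_set.
by apply/negP => /andP[fT /andP[fF _]]; apply: noF; exists f.
Qed.

End PosetTableaux.

(** * Stanley-Reisner ideals and coordinates on the vertices *)

(** For [D] closed under subsets, a monomial is divisible by the product of a non-face exactly when
    its own support is a non-face. *)
Lemma SR_idealP (k : fieldType) (U : finType) (V : {set U}) (D : {set {set U}})
    (p : {mpoly k[#|V|]}) :
  (forall A B : {set 'I_#|V|}, A \subset B ->
     enum_val @: B \in D -> enum_val @: A \in D) ->
  SR_ideal D p <->
  {in msupp p, forall m : 'X_{1..#|V|},
     enum_val @: [set i | m i != 0%N] \notin D}.
Proof.
move=> Dsub; have prodE (B : {set 'I_#|V|}) :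
    \prod_(v in enum_val @: B) pvar k V v = 'X_[mnm_ind B].
  rewrite mpolyX_ind big_imset /=; last by move=> i j _ _; apply: enum_val_inj.
  apply: eq_bigr => i _; rewrite /pvar; case: pickP => [j /eqP/enum_val_inj -> //|].
  by move=> /(_ i); rewrite eqxx.
split=> [[c ->] m|hp].
  move/msupp_sum_le/flattenP => [s /mapP[G]]; rewrite mem_filter.
  case/andP=> /andP[GV GD] _ -> /msuppM_le/allpairsP[[m1 m2] /= [_ + ->]].
  pose B := [set i : 'I_#|V| | enum_val i \in G].
  have GE : G = enum_val @: B.
    apply/setP => v; apply/idP/imsetP => [Gv|[i + ->]]; last by rewrite inE.
    have Vv := subsetP GV v Gv; exists (enum_rank_in Vv v);
      by rewrite ?inE enum_rankK_in.
  rewrite {1}GE prodE => /mem_msuppXP <-; apply: contra GD.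
  rewrite GE; apply: Dsub; apply/subsetP => i iB.
  by rewrite inE mnmDE mnmE iB addn1.
rewrite [p]mpolyE big_seq; apply: (big_ind (SR_ideal D)).
- by exists (fun=> 0); rewrite big1 // => G _; rewrite mul0r.
- move=> x y [c ->] [d ->]; exists (fun G => c G + d G).
  by rewrite -big_split /=; apply: eq_bigr => G _; rewrite mulrDl.
- move=> m /hp mD; set A := [set i | m i != 0%N] in mD.
  pose G := enum_val @: A.
  (* The term is a multiple of the generator given by its own support. *)
  exists (fun G' => if G' == G then p@_m *: 'X_[m - mnm_ind A] else 0).
  rewrite (bigD1 G) /= ?eqxx.
    rewrite [X in _ + X]big1 ?addr0 => [|G' /andP[_ /negPf ->]]; last by rewrite mul0r.
    rewrite prodE -scalerAl -mpolyXD submK //; apply/mnm_lepP => i.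
    by rewrite mnmE inE; case: (m i).
  rewrite mD andbT; apply/subsetP => v /imsetP[i _ ->]; exact: enum_valP.
Qed.

Section Vertices.
Variables (X Y : finType) (E : {set X * Y}).
Let V := tab_ground E.

Lemma tab_vertex_inj : {in E &, injective (tab_vertex E)}.
Proof.
move=> e e' Ee Ee' /setP/(_ e); rewrite !inE Ee eqxx /= andbT.
by move/esym/negbFE/eqP.
Qed.

(** As [tab_vertex E] is injective on [E], the variables can be labelled by the pairs in [E]. *)
Lemma tab_ground_coordinates : exists ed : 'I_#|V| -> X * Y,
  [/\ forall i, ed i \in E, forall i, enum_val i = tab_vertex E (ed i),
      injective ed & forall e, e \in E -> exists i, ed i = e].
Proof.
have [ed edP] : exists ed : 'I_#|V| -> X * Y,
    forall i, ed i \in E /\ enum_val i = tab_vertex E (ed i).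
  apply: (fin_all_exists (P := fun i e => e \in E /\ enum_val i = tab_vertex E e)).
  by move=> i; have /imsetP[e Ee ->] := enum_valP i; exists e.
have edE i := proj1 (edP i); have edV i := proj2 (edP i).
exists ed; split=> // [i j eij|e Ee].
  by apply: enum_val_inj; rewrite !edV eij.
have Ve : tab_vertex E e \in V by apply: imset_f.
exists (enum_rank_in Ve (tab_vertex E e)).
by apply: tab_vertex_inj; rewrite // -edV enum_rankK_in.
Qed.

Variable ed : 'I_#|V| -> X * Y.
Hypothesis ed_in : forall i, ed i \in E.
Hypothesis enum_val_ed : forall i, enum_val i = tab_vertex E (ed i).
Hypothesis ed_inj : injective ed.
Hypothesis ed_onto : forall e, e \in E -> exists i, ed i = e.

Lemma pvar_ed (R : nzRingType) i : pvar R V (tab_vertex E (ed i)) = 'X_i.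
Proof.
rewrite /pvar -enum_val_ed; case: pickP => [j /eqP/enum_val_inj -> //|].
by move=> /(_ i); rewrite eqxx.
Qed.

Lemma imset_ed (E' : {set X * Y}) :
  E' \subset E -> ed @: [set i | ed i \in E'] = E'.
Proof.
move=> /subsetP sE; apply/setP => e; apply/imsetP/idP => [[i + ->]|E'e].
  by rewrite inE.
by have [i eE] := ed_onto (sE _ E'e); exists i; rewrite ?inE eE.
Qed.

Lemma big_ed (R : Type) (idx : R) (op : Monoid.com_law idx) (E' : {set X * Y})
    (g : X * Y -> R) : E' \subset E ->
  \big[op/idx]_(i in [set i | ed i \in E']) g (ed i) =
  \big[op/idx]_(e in E') g e.
Proof.
move=> sE; rewrite -{2}(imset_ed sE) big_imset //= => i j _ _; exact: ed_inj.
Qed.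

Lemma card_ed (E' : {set X * Y}) :
  E' \subset E -> #|[set i | ed i \in E']| = #|E'|.
Proof. by move=> sE; rewrite -[in RHS](imset_ed sE) [RHS]card_imset. Qed.

Variable T : {set {ffun X -> Y}}.
Hypothesis graph_sub : {in T, forall f, graph f \subset E}.

Lemma tableau_complex_ed (A : {set 'I_#|V|}) :
  (enum_val @: A \in tableau_complex T E) =
  [exists f in T, [disjoint A & [set i | ed i \in graph f]]].
Proof.
apply/imsetP/exists_inP => [[F]|[f fT dA]].
  rewrite inE => /andP[_ /exists_inP[f fT /subsetP fF]] AE; exists f => //.
  apply/pred0P => i /=; rewrite inE; apply/negP => /andP[Ai /fF edF].
  have : enum_val i \in enum_val @: A by apply: imset_f.
  rewrite AE => /imsetP[e]; rewrite inE => /andP[eF Ee]; rewrite enum_val_ed.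
  by move/tab_vertex_inj => eE; rewrite -eE ?edF in eF.
(* The complement of [A] contains [graph f], because [A] is disjoint from it. *)
exists (E :\: ed @: A).
  rewrite inE powersetE subsetDl; apply/exists_inP; exists f => //.
  apply/subsetP => e fe; rewrite inE (subsetP (graph_sub fT)) // andbT.
  apply/imsetP => -[i Ai eE]; move: (disjointFr dA Ai); rewrite inE -eE.
  by rewrite fe.
apply/setP => v; apply/imsetP/imsetP => [[i Ai ->]|[e]].
  exists (ed i); last exact: enum_val_ed.
  by rewrite !inE ed_in !andbT negbK imset_f.
rewrite !inE => /andP[+ Ee] ->; rewrite Ee andbT negbK => /imsetP[i Ai ->].
by exists i; rewrite ?enum_val_ed.
Qed.

Lemma SR_tableau_idealP (k : fieldType) (p : {mpoly k[#|V|]}) :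
  SR_ideal (tableau_complex T E) p <->
  {in msupp p, forall m,
     ~~ [exists f in T, avoids [set i | ed i \in graph f] m]}.
Proof.
rewrite SR_idealP => [|A B sAB]; last first.
  rewrite !tableau_complex_ed => /exists_inP[f fT dB]; apply/exists_inP.
  by exists f => //; apply: disjointWl dB.
suff eqf (m : 'X_{1..#|V|}) :
    (enum_val @: [set i | m i != 0%N] \in tableau_complex T E)
    = [exists f in T, avoids [set i | ed i \in graph f] m].
  by split=> h m /h; rewrite eqf.
rewrite tableau_complex_ed; apply: eq_existsb => f; congr (_ && _).
rewrite disjoint_sym disjoint_subset; apply/subsetP/forall_inP => h i Zi.
  by have := h i Zi; rewrite !inE negbK.
by rewrite !inE negbK h.
Qed.

End Vertices.

(** * The tableau complex as a partitioned complex *)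

Unset Implicit Arguments.

Theorem theorem4p5 (k : fieldType) (dX dY : Order.disp_t)
    (X : finPOrderType dX) (Y : finPOrderType dY)
    (Y_ : X -> {set Y}) (Psi : {set X * X})
    (hY : forall x, {in Y_ x &, total (@Order.le dY Y)})
    (hPsi : forall x1 x2, (x1, x2) \in Psi -> (x1 < x2)%O) :
  let T := poset_tableaux Y_ Psi in
  let E := tab_union T in
  let V := tab_ground E in
  let I := @SR_ideal k _ V (tableau_complex T E) in
  let t := fun (x : X) (y : Y) => pvar int V (tab_vertex E (x, y)) in
  (forall K : {mpoly int[#|V|]},
     is_K_polynomial I K <->
     K = \sum_(f in T) \prod_(x : X)
           ((1 - t x (f x)) * \prod_(y in up_moves T f x) t x y)) /\
  (exists h : seq int, is_h_vector I h) /\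
  (forall h : seq int, is_h_vector I h -> forall j : nat,
     h`_j = #|[set f in T | (\sum_(x : X) #|up_moves T f x|)%N == j]|%:Z).
Proof.
move=> T E V I t.
have [ed [ed_in edV ed_inj ed_onto]] := tab_ground_coordinates E.
pose upE f := [set e : X * Y | e.2 \in up_moves T f e.1].
pose cf f := [set i | ed i \in graph f].
pose up f := [set i | ed i \in upE f].
have graphE : {in T, forall f, graph f \subset E}.
  by move=> f fT; apply: bigcup_sup.
have upEE f : upE f \subset E.
  (* The raised tableau is in [T] and passes through [(x, y)], so this pair is in [E]. *)
  apply/subsetP => -[x y]; rewrite [_ \in upE f]inE [_ \in up_moves _ _ _]inE /=.
  by case/andP=> _ cT; apply: (subsetP (graphE _ cT)); rewrite graphP ffunE eqxx.
have cf_up : {in T, forall f, [disjoint cf f & up f]}.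
  move=> f _; apply/pred0P => i /=; rewrite !inE; case: (ed i) => x y /=.
  by rewrite graphP; case: eqP => //= ->; rewrite ltxx.
have card_cf : {in T, forall f, #|cf f| = #|X|}.
  move=> f fT; rewrite (card_ed ed_inj ed_onto (graphE _ fT)).
  by rewrite card_imset // => x x' [].
have card_up f : #|up f| = (\sum_x #|up_moves T f x|)%N.
  rewrite (card_ed ed_inj ed_onto (upEE f)) -sum1_card.
  under [RHS]eq_bigr => x _ do rewrite -sum1_card.
  by rewrite pair_big_dep /=; apply: eq_bigl => e; rewrite inE.
have intervals (A : {set 'I_#|V|}) :
    #|[set f in T | (up f \subset A) && [disjoint A & cf f]]| =
    [exists f in T, [disjoint A & cf f]] :> nat.
  (* The tableaux of [T] whose interval contains [A] are those locally maximal in the complement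
     [F]. *)
  pose F := E :\: ed @: A.
  have cfF f : f \in T -> [disjoint A & cf f] = (graph f \subset F) :> bool.
    move=> fT; rewrite disjoint_sym disjoint_subset.
    apply/subsetP/subsetP => h => [e fe|i].
      have [i eE] := ed_onto _ (subsetP (graphE _ fT) _ fe); subst e.
      rewrite inE ed_in andbT (mem_imset _ _ ed_inj).
      by have := h i; rewrite !inE; apply.
    by rewrite !inE => /h; rewrite inE (mem_imset _ _ ed_inj) => /andP[].
  have upF f : (up f \subset A) =
      [forall x, forall y in up_moves T f x, (x, y) \notin F].
    apply/subsetP/forallP => [h x|h i].
      apply/forall_inP => y uy.
      have uxy : (x, y) \in upE f by rewrite inE.
      have [i eE] := ed_onto _ (subsetP (upEE f) _ uxy).
      by rewrite -eE inE ed_in andbT negbK (mem_imset _ _ ed_inj) h // inE eE.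
    rewrite inE [_ \in upE f]inE => ui.
    have /forall_inP/(_ _ ui) := h (ed i).1.
    by rewrite -surjective_pairing inE ed_in andbT negbK (mem_imset _ _ ed_inj).
  have -> : [exists f in T, [disjoint A & cf f]] =
            [exists f in T, graph f \subset F].
    by apply: eq_existsb => f; case: (boolP (f \in T)) => //= fT; rewrite cfF.
  rewrite -(card_locally_maximal hY hPsi F); apply: eq_card => f.
  rewrite in_set [RHS]in_set; case: (boolP (f \in T)) => //= fT.
  by rewrite /locally_maximal -cfF // -upF andbC.
have I_msupp := SR_tableau_idealP ed_in edV graphE (k := k).
split; [|split].
- move=> K; rewrite (is_K_polynomialP cf_up intervals I_msupp).
  suff -> : \sum_(f in T) K_summand cf up f = \sum_(f in T) \prod_(x : X)
      ((1 - t x (f x)) * \prod_(y in up_moves T f x) t x y) by [].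
  (* The product over [x] splits into one over [graph f] and one over [upE f], each reindexed by
     [ed]. *)
  apply: eq_bigr => f fT; rewrite big_split /=.
  pose g e := pvar int V (tab_vertex E e).
  have gE i : g (ed i) = 'X_i by apply: pvar_ed.
  congr (_ * _).
    under eq_bigr => i _ do rewrite -gE.
    rewrite (big_ed ed_inj ed_onto _ (fun e => 1 - g e) (graphE _ fT)).
    by rewrite big_imset //= => x x' _ _ [].
  under eq_bigr => i _ do rewrite -gE.
  rewrite (big_ed ed_inj ed_onto _ g (upEE f)) pair_big_dep /=.
  by apply: eq_big => [e|[x y]]; rewrite ?inE.
- exact: h_vector_exists cf_up card_cf intervals I_msupp.
- move=> h hh j.
  rewrite (h_vectorE cf_up card_cf intervals I_msupp j hh); congr (Posz _).
  by apply: eq_card => f; rewrite in_set [RHS]in_set card_up.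
Qed.
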